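(* Let $(p_1,p_2,\dots,p_l,p_{l+1})$ be an $(l+1)$-tuple of pairwise relatively prime integers with $1<p_1<p_2<\dots<p_l<p_{l+1}$. Then $$\kappa(p_1,p_2,\dots,p_l)\le\kappa(p_1,p_2,\dots,p_l,p_{l+1}).$$
   Context: For pairwise relatively prime integers $1<p_1<\dots<p_m$, let $(e_0,p_1',\dots,p_m')$ be the unique integers with $1\le p_i'\le p_i-1$ and $e_0p_1\cdots p_m+\sum_{i=1}^m p_i'\prod_{j\ne i}p_j=-1$ (these depend on the whole tuple). Define $$\Delta(n)=1+|e_0|n-\sum_{i=1}^m\left\lceil\frac{np_i'}{p_i}\right\rceil\quad(n\in\mathbb{Z}_{\ge0}),\qquad \kappa(p_1,\dots,p_m)=\left|\sum_{n=0}^\infty\min\{0,\Delta(n)\}\right| .$$ *)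

(* Defs.v *)
From HB Require Import structures.
From mathcomp Require Import all_boot all_order all_algebra.
From mathcomp Require Import mathcomp_extra boolp classical_sets functions.
From mathcomp Require Import cardinality fsbigop.

Set Implicit Arguments.
Unset Strict Implicit.
Unset Printing Implicit Defensive.

Import Order.TTheory GRing.Theory Num.Theory.

Local Open Scope classical_set_scope.
Local Open Scope ring_scope.

Definition pairwise_coprimez m (p : 'I_m -> int) : Prop :=
  forall i j : 'I_m, i != j -> coprimez (p i) (p j).

(* [d] stands for the pair (e_0, (p_1', ..., p_m')). *)
Definition is_invariants m (p : 'I_m -> int) (d : int * {ffun 'I_m -> int}) :
    Prop :=
  (forall i : 'I_m, 1 <= d.2 i <= p i - 1) /\
  d.1 * (\prod_(i < m) p i) + \sum_(i < m) d.2 i * \prod_(j < m | j != i) p j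
    = -1.

(* The default value is only reached when no such pair exists; existence and
   uniqueness for pairwise coprime p_i > 1 are proved below. *)
Definition invariants m (p : 'I_m -> int) : int * {ffun 'I_m -> int} :=
  xget (0, [ffun=> 0]) [set d | is_invariants p d].

Definition e0 m (p : 'I_m -> int) : int := (invariants p).1.

Definition pprime m (p : 'I_m -> int) (i : 'I_m) : int := (invariants p).2 i.

Definition Delta m (p : 'I_m -> int) (n : nat) : int :=
  1 + `|e0 p| * n%:Z
  - \sum_(i < m) Num.ceil ((n%:Z * pprime p i)%:~R / (p i)%:~R : rat).

(* The series has finitely many nonzero terms (see [finite_support_Delta]), so
   it is the finitely supported sum over all natural numbers. *)
Definition kappa m (p : 'I_m -> int) : int :=
  `| \sum_(n \in [set: nat]) Num.min 0 (Delta p n) |.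

Section WellDefined.
Variables (m : nat) (p : 'I_m -> int).
Hypotheses (p_gt1 : forall i, 1 < p i) (p_coprime : pairwise_coprimez p).

Let P := \prod_(i < m) p i.
Let Q i := \prod_(j < m | j != i) p j.

Let PQ i : P = p i * Q i. Proof. by rewrite /P /Q (bigD1 i). Qed.

Let p_gt0 i : 0 < p i. Proof. exact: lt_trans (p_gt1 i). Qed.

Let P_gt0 : 0 < P. Proof. by apply: prodr_gt0 => i _. Qed.

Let coprime_prod (r : seq 'I_m) (A : pred 'I_m) x :
  (forall j, A j -> coprimez x (p j)) ->
  coprimez x (\prod_(j <- r | A j) p j).
Proof.
move=> h; elim/big_rec: _ => [|j y Aj xy]; first by rewrite coprimezE coprimen1.
by rewrite coprimezMr h.
Qed.

Let coprime_Q i : coprimez (p i) (Q i).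
Proof. by apply: coprime_prod => j ji; apply: p_coprime; rewrite eq_sym. Qed.

Let dvd_Q i j : j != i -> (p i %| Q j)%Z.
Proof.
by move=> ji; rewrite /Q (bigD1 i) 1?eq_sym //=; apply: dvdz_mulr; apply: dvdzz.
Qed.

Let dvd_prod x : (forall i, (p i %| x)%Z) -> (P %| x)%Z.
Proof.
move=> h; rewrite /P; elim: (index_enum _) (index_enum_uniq 'I_m) => [|i r IH] /=.
  by rewrite big_nil dvd1z.
case/andP=> ir ur; rewrite big_cons Gauss_dvdz ?h ?IH //.
rewrite big_seq_cond; apply: coprime_prod => j /andP[jr _].
by apply: p_coprime; apply: contraNneq ir => ->.
Qed.

Let sum_mod (f : 'I_m -> int) i :
  (p i %| \sum_(j < m) f j * Q j - f i * Q i)%Z.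
Proof.
rewrite (bigD1 i) //= addrAC subrr add0r.
by apply: rpred_sum => j ji; apply: dvdz_mull; apply: dvd_Q.
Qed.

Lemma invariants_exist : exists d, is_invariants p d.
Proof.
have bez i : exists c, (p i %| c * Q i + 1)%Z.
  have /coprimezP[[u v] /= uv] := coprime_Q i.
  exists (- v); rewrite -uv mulNr addrCA addNr addr0; exact/dvdz_mull/dvdzz.
pose c i := xchoose (bez i); pose f := [ffun i => (c i %% p i)%Z].
have fQ i : (p i %| f i * Q i + 1)%Z.
  have := xchooseP (bez i); rewrite -/(c i) {1}(divz_eq (c i) (p i)) mulrDl -addrA.
  rewrite rpredDl ?ffunE //; first by rewrite mulrAC; apply/dvdz_mull/dvdzz.
have : (P %| \sum_(j < m) f j * Q j + 1)%Z.
  apply: dvd_prod => i.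
  rewrite -[\sum_(_ < _) _](subrK (f i * Q i)) -addrA rpredD ?sum_mod //.
rewrite dvdz_eq; set q := (_ %/ _)%Z => /eqP qP; exists (- q, f); split => [i|] /=.
  have p0 : p i != 0 by rewrite gt_eqF.
  have f_lt : f i < p i by rewrite ffunE ltz_pmod.
  have f_ge0 : 0 <= f i by rewrite ffunE modz_ge0.
  rewrite -gtz0_ge1 lt0r f_ge0 andbT.
  rewrite lerBrDr lezD1 f_lt andbT.
  apply: contraTneq (fQ i) => ->; rewrite mul0r add0r dvdz1.
  by case: (p i) (p_gt1 i) => [[|[]]|].
by rewrite -/P mulNr qP opprD addrAC addNr add0r.
Qed.

Lemma invariants_unique d d' : is_invariants p d -> is_invariants p d' -> d = d'.
Proof.
case: d d' => [e f] [e' f'] [/= fp fe] [/= fp' fe'].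
have dvd1 (a : int) (g : {ffun 'I_m -> int}) i :
    a * P + \sum_(j < m) g j * Q j = -1 -> (p i %| g i * Q i + 1)%Z.
  move=> h; rewrite -[1]opprK -h opprD addrCA rpredD //.
    by rewrite rpredN (PQ i) mulrCA; apply/dvdz_mulr/dvdzz.
  by rewrite -rpredN opprB sum_mod.
have ff' : f = f'.
  apply/ffunP => i.
  have: (p i %| (f i - f' i) * Q i)%Z.
    rewrite (_ : _ * _ = (f i * Q i + 1) - (f' i * Q i + 1)); last first.
      by rewrite mulrBl opprD addrACA subrr addr0.
    by rewrite rpredB ?(dvd1 _ _ _ fe) ?(dvd1 _ _ _ fe').
  rewrite Gauss_dvdzl // -eqz_mod_dvd.
  have small g : 1 <= g <= p i - 1 -> (g %% p i)%Z = g.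
    case/andP=> g1; rewrite lerBrDr lezD1 => gp.
    by rewrite modz_small // gp (le_trans _ g1).
  by rewrite !small // => /eqP.
move: fe; rewrite -fe' ff' => /addIr/mulIf -> //; by rewrite gt_eqF.
Qed.

Lemma invariantsP : is_invariants p (invariants p).
Proof. by have := xgetPex (0, [ffun=> 0]) invariants_exist. Qed.

Lemma finite_support_Delta : finite_set [set n | Num.min 0 (Delta p n) != 0].
Proof.
apply: (sub_finite_set _ (finite_II (m * `|P|)%N)) => n /=.
apply: contraNT; rewrite -leqNgt => le_n; apply/eqP/min_idPl.
have [_] := invariantsP; rewrite -/P -/(e0 p) => eP.
have P0 : P%:~R != 0 :> rat by rewrite intr_eq0 gt_eqF.
pose x i : rat := (n%:Z * pprime p i)%:~R / (p i)%:~R.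
have sum_x : \sum_(i < m) x i = n%:R * (- P%:~R^-1 - (e0 p)%:~R).
  have -> : - P%:~R^-1 - (e0 p)%:~R =
      (\sum_(i < m) pprime p i * Q i)%:~R / P%:~R :> rat.
    move/(congr1 (fun z : int => z%:~R / P%:~R : rat)): eP.
    rewrite rmorphD rmorphM /= mulrDl mulfK // rmorphN1 mulN1r => <-.
    by rewrite addrAC subrr add0r.
  rewrite rmorph_sum mulr_suml mulr_sumr; apply: eq_bigr => i _.
  rewrite /x (PQ i) !rmorphM /= -!mulrA; congr (_ * (_ * _)).
  have Q0 : (Q i)%:~R != 0 :> rat.
    by move: P0; rewrite (PQ i) rmorphM mulf_eq0 negb_or => /andP[].
  by rewrite invfM mulrCA divff // mulr1.
have le_ceil : (\sum_(i < m) Num.ceil (x i))%:~R <= m%:R + \sum_(i < m) x i.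
  have -> : m%:R = \sum_(i < m) 1 :> rat by rewrite sumr_const card_ord.
  rewrite rmorph_sum -big_split; apply: ler_sum => i _ /=.
  by have /andP[/ltW] := ceil_itv (x i); rewrite rmorphB /= lerBlDl.
rewrite -(ler_int rat) /Delta rmorphB rmorphD rmorphM /=.
rewrite subr_ge0 (le_trans le_ceil) // sum_x mulrBr mulrN addrA lerD //.
  rewrite lerBlDr (@le_trans _ _ (n%:R / P%:~R)) ?lerDr //.
  rewrite ler_pdivlMr ?ltr0z // -[P]gtz0_abs // -pmulrn.
  by rewrite -natrM ler_nat.
rewrite -mulrN mulrC ler_wpM2r // -rmorphN ler_int -normrN; exact: ler_norm.
Qed.

End WellDefined.

(* Main.v *)
Require Import Defs.
From mathcomp Require Import all_boot all_order all_algebra.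
From mathcomp Require Import ring zify.
From mathcomp Require Import classical_sets functions cardinality fsbigop.

(** Put [P = p_1 ... p_m] and [Q_i = P / p_i].  The equation defining the
    invariants turns [Delta] into
    [P * Delta n = P + n - \sum_i r_i * Q_i], where [r_i] is the residue of
    [- n p_i'] modulo [p_i].  When a further modulus [q] is added and [n] is
    replaced by [n q], the new residue [r_(m+1)] vanishes and the old ones are
    unchanged, because [q] times the new [p_i'] is congruent to the old [p_i']
    modulo [p_i].  Hence [Delta n] for the short tuple equals [Delta (n q)] for
    the long one, and the sum defining [kappa] for the short tuple is a
    sub-sum, with terms of constant sign, of the one for the long tuple. *)

Set Implicit Arguments.
Unset Strict Implicit.
Unset Printing Implicit Defensive.

Import Order.TTheory GRing.Theory Num.Theory.

Local Open Scope classical_set_scope.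
Local Open Scope ring_scope.

(** By injectivity the right side is the sum of [F] over the range of [h]; the left side adds only
    nonpositive terms. Finite support matters: a sum with infinite support takes the default value
    0. *)
Lemma le_fsumr_reindex (R : numDomainType) (I J : choiceType) (h : I -> J)
    (F : J -> R) :
  injective h -> (forall j, F j <= 0) -> finite_set [set j | F j != 0] ->
  \sum_(j \in [set: J]) F j <= \sum_(i \in [set: I]) F (h i).
Proof.
move=> h_inj F_le0 F_fin.
rewrite -(fsbig_image [set: I] h F); last by move=> x y _ _ /h_inj.
rewrite [leLHS]fsbig_supp [leRHS]fsbig_supp setTI.
have suppE : F @^-1` [set~ 0] = [set j | F j != 0].
  by apply/seteqP; split => j /= /eqP.
rewrite suppE (fsbigID (range h)) //= [range h `&` _]setIC gerDl.
by apply: fsumr_le0.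
Qed.

Lemma ceil_intdivE (a b : int) : 0 < b ->
  Num.ceil (a%:~R / b%:~R : rat) * b = a + (- a %% b)%Z.
Proof.
move=> b_gt0; have b_neq0 : b != 0 by rewrite gt_eqF.
have divE := divz_eq (- a) b.
(* For [b > 0], [%/] is the floor, and the ceiling of [x] is minus the floor of [-x]. *)
rewrite (_ : Num.ceil _ = - (- a %/ b)%Z); first by lia.
apply: ceil_def; rewrite ltr_pdivlMr ?ltr0z // ler_pdivrMr ?ltr0z //.
rewrite -!rmorphM /= ltr_int ler_int.
have := modz_ge0 (- a) b_neq0; have := ltz_pmod (- a) b_gt0; lia.
Qed.

Definition cofactor m (p : 'I_m -> int) (i : 'I_m) : int :=
  \prod_(j < m | j != i) p j.

Lemma cofactorE m (p : 'I_m -> int) i : \prod_(j < m) p j = p i * cofactor p i.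
Proof. by rewrite (bigD1 i). Qed.

Section Invariants.
Variables (m : nat) (p : 'I_m -> int).
Hypotheses (p_gt1 : forall i, 1 < p i) (p_coprime : pairwise_coprimez p).

Let p_gt0 i : 0 < p i. Proof. exact: lt_trans (p_gt1 i). Qed.

(** Reduce the defining equation modulo [p i]: every term except the [i]-th contains the factor
    [p i]. *)
Lemma pprime_cofactor i : (p i %| pprime p i * cofactor p i + 1)%Z.
Proof.
have [_] := invariantsP p_gt1 p_coprime.
rewrite -/(e0 p) [X in _ + X](bigD1 i) //= -/(pprime p i) -/(cofactor p i).
rewrite (cofactorE p i).
set s := \sum_(_ < _ | _) _ => eqP.
have -> : pprime p i * cofactor p i + 1 = - (e0 p * cofactor p i * p i + s).
  by move: eqP; lia.
rewrite rpredN rpredD ?dvdz_mull // rpred_sum // => j ji.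
by rewrite dvdz_mull // (bigD1 i) 1?eq_sym //= dvdz_mulr.
Qed.

(** The defining equation reads [e0 * P = -1 - s] with [P > 0] and [s >= 0]. *)
Lemma normr_e0 : `|e0 p| = - e0 p.
Proof.
have [pp_itv] := invariantsP p_gt1 p_coprime.
rewrite -/(e0 p); set P := \prod_(_ < _) _; set s := \sum_(_ < _) _ => eqP.
have P_gt0 : 0 < P by apply: prodr_gt0.
have s_ge0 : 0 <= s.
  apply: sumr_ge0 => i _; have /andP[pp_ge1 _] := pp_itv i.
  rewrite mulr_ge0 ?(le_trans ler01 pp_ge1) // prodr_ge0 //.
  by move=> j _; apply: ltW.
by rewrite ler0_norm // -(pmulr_lle0 _ P_gt0); lia.
Qed.

Lemma prod_Delta n : (\prod_(i < m) p i) * Delta p n =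
  \prod_(i < m) p i + n%:Z
  - \sum_(i < m) (- (n%:Z * pprime p i) %% p i)%Z * cofactor p i.
Proof.
have [_] := invariantsP p_gt1 p_coprime.
rewrite /Delta normr_e0 -/(e0 p).
set P := \prod_(_ < _) _; set c := \sum_(_ < _) Num.ceil _.
set r := \sum_(_ < _) (_ %% _)%Z * _.
have -> : \sum_(i < m) (invariants p).2 i * \prod_(j < m | j != i) p j =
          \sum_(i < m) pprime p i * cofactor p i by [].
set s := \sum_(_ < _) pprime _ _ * _ => eqP.
have : c * P = n%:Z * s + r.
  rewrite mulr_suml mulr_sumr -big_split; apply: eq_bigr => i _ /=.
  by rewrite /P (cofactorE p i) mulrA ceil_intdivE // mulrDl mulrA.
have -> : s = -1 - e0 p * P by move: eqP; lia.
by clear; move: P c r (e0 p) n%:Z => P c r e k; lia.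
Qed.

End Invariants.

Section Extension.
Variables (l : nat) (p : 'I_l.+1 -> int).
Hypotheses (p_gt1 : forall i, 1 < p i) (p_coprime : pairwise_coprimez p).

Let p' (i : 'I_l) : int := p (widen_ord (leqnSn l) i).
Let q := p ord_max.

Let p'_gt1 i : 1 < p' i. Proof. exact: p_gt1. Qed.

Let p'_coprime : pairwise_coprimez p'.
Proof. by move=> i j ij; apply: p_coprime. Qed.

Lemma cofactor_widen i :
  cofactor p (widen_ord (leqnSn l) i) = cofactor p' i * q.
Proof.
rewrite /cofactor big_mkcond big_ord_recr /= -big_mkcond /=.
by rewrite -val_eqE /= gtn_eqF.
Qed.

Lemma pprime_widen i :
  (p' i %| q * pprime p (widen_ord (leqnSn l) i) - pprime p' i)%Z.
Proof.
have := pprime_cofactor p_gt1 p_coprime (widen_ord (leqnSn l) i).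
have := pprime_cofactor p'_gt1 p'_coprime i.
rewrite cofactor_widen -/(p' i).
move: (pprime p' i) (pprime p _) (cofactor p' i) => u' u Q u'Q uQ.
(* Modulo [p' i], both [q * u] and [u'] are inverses of [-Q], hence congruent. *)
have -> : q * u - u' = q * u * (u' * Q + 1) - u' * (u * (Q * q) + 1) by ring.
by rewrite rpredB ?dvdz_mull.
Qed.

Lemma Delta_widen n : Delta p (n * `|q|%N) = Delta p' n.
Proof.
have q_gt0 : 0 < q by apply: lt_trans (p_gt1 _).
have P_gt0 : 0 < \prod_(i < l.+1) p i.
  by apply: prodr_gt0 => i _; apply: lt_trans (p_gt1 i).
apply: (mulfI (lt0r_neq0 P_gt0)).
rewrite prod_Delta // PoszM gtz0_abs // !big_ord_recr /= -/q.
have -> : (- (n%:Z * q * pprime p ord_max) %% q)%Z = 0.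
  by rewrite mulrAC -mulNr modzMl.
(* The long product is [q] times the short one, so the short formula applies, scaled by [q]. *)
rewrite mul0r addr0 [RHS]mulrAC (prod_Delta p'_gt1 p'_coprime).
rewrite [RHS]mulrBl [X in _ = X - _]mulrDl mulr_suml.
congr (_ - _).
apply: eq_bigr => i _; rewrite cofactor_widen mulrA; congr (_ * _ * _).
apply/eqP; rewrite eqz_mod_dvd -/(p' i).
rewrite (_ : _ - _ = - n%:Z * (q * pprime p (widen_ord (leqnSn l) i)
                               - pprime p' i)); last by ring.
by rewrite dvdz_mull // pprime_widen.
Qed.

End Extension.

Theorem proposition4p13 (l : nat) (p : 'I_l.+1 -> int)
    (l_gt0 : (0 < l)%N)
    (p_gt1 : forall i : 'I_l.+1, 1 < p i)
    (p_incr : forall i j : 'I_l.+1, (i < j)%N -> p i < p j)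
    (p_coprime : pairwise_coprimez p) :
  kappa (fun i : 'I_l => p (widen_ord (leqnSn l) i)) <= kappa p.
Proof.
have term_le0 n : Num.min 0 (Delta p n) <= 0 by rewrite ge_min lexx.
rewrite /kappa.
under eq_fsbigr do rewrite -Delta_widen //.
(* Both sums are nonpositive, so removing the absolute values reverses the inequality. *)
rewrite !ler0_norm ?fsumr_le0 // lerN2.
apply: (le_fsumr_reindex (h := fun n => (n * `|p ord_max|)%N)
                         (F := fun n => Num.min 0 (Delta p n))) => //.
  by move=> a b /eqP; rewrite eqn_pmul2r => [/eqP|]; have := p_gt1 ord_max; lia.
exact: finite_support_Delta.
Qed.
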